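(* Let $A,B,C$ be (possibly rectangular) complex matrices such that the product $ABC$ is defined, and let $P=A^\dagger ABCC^\dagger$ and $Q=CC^\dagger B^\dagger A^\dagger A$. The following conditions are equivalent: (i) $(ABC)^{\dagger}=C^\dagger B^\dagger A^\dagger$; (ii) $Q\in P\{1,2\}$ and both of $A^*APQ$ and $QPCC^*$ are Hermitian; (iii) $Q\in P\{1,2\}$ and both of $A^*APQ$ and $QPCC^*$ are EP; (iv$'$) $Q\in P\{1\}$, $\mathcal{R}(Q^* )\subseteq \mathcal{R}(A^*AP)$ and $\mathcal{R}(CC^*P^* )\subseteq \mathcal{R}(Q)$; (iv$''$) $Q\in P\{1\}$, $\mathcal{R}(A^*AP)\subseteq \mathcal{R}(Q^* )$ and $\mathcal{R}(Q)\subseteq \mathcal{R}(CC^*P^* )$; (iv$'''$) $Q\in P\{1\}$, $\mathcal{R}(Q^* )\subseteq \mathcal{R}(A^*AP)$ and $\mathcal{R}(Q)\subseteq \mathcal{R}(CC^*P^* )$; (iv$''''$) $Q\in P\{2\}$, $\mathcal{R}(Q^* )\subseteq \mathcal{R}(A^*AP)$ and $\mathcal{R}(CC^*P^* )\subseteq \mathcal{R}(Q)$; (iv$'''''$) $Q\in P\{2\}$, $\mathcal{R}(A^*AP)\subseteq \mathcal{R}(Q^* )$ and $\mathcal{R}(Q)\subseteq \mathcal{R}(CC^*P^* )$; (iv$''''''$) $Q\in P\{2\}$, $\mathcal{R}(A^*AP)\subseteq \mathcal{R}(Q^* )$ and $\mathcal{R}(CC^*P^* )\subseteq \mathcal{R}(Q)$;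 (v$'$) $PQ=(PQ)^2$, $\mathcal{R}(Q^* )\subseteq \mathcal{R}(A^*AP)$ and $\mathcal{R}(CC^*P^* )\subseteq \mathcal{R}(Q)$; (v$''$) $PQ=(PQ)^2$, $\mathcal{R}(A^*AP)\subseteq \mathcal{R}(Q^* )$ and $\mathcal{R}(Q)\subseteq \mathcal{R}(CC^*P^* )$.
   Context: For a complex matrix $M$, $M^*$ is its conjugate transpose and $\mathcal{R}(M)$ is its range (column space). For a complex $m\times n$ matrix $M$, the four Penrose equations for an $n\times m$ matrix $N$ are: (1) $MNM=M$; (2) $NMN=N$; (3) $(MN)^*=MN$; (4) $(NM)^*=NM$. $M^\dagger$ denotes the Moore-Penrose inverse, the unique matrix satisfying all four. $M\{i,\ldots,j\}$ denotes the set of all matrices $N$ satisfying equations $(i),\ldots,(j)$; in particular $M\{1\}=\{N: MNM=M\}$, $M\{2\}=\{N: NMN=N\}$ and $M\{1,2\}=M\{1\}\cap M\{2\}$. A square matrix $M$ is Hermitian if $M^*=M$ and EP if $\mathcal{R}(M)=\mathcal{R}(M^* )$. *)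

(* Defs.v *)
From mathcomp Require Import all_boot all_order all_algebra.
From mathcomp Require Import sesquilinear spectral.
From mathcomp Require Import complex.
From mathcomp Require Import boolp classical_sets reals.

Set Implicit Arguments.
Unset Strict Implicit.
Unset Printing Implicit Defensive.

Import GRing.Theory Num.Theory Num.Def.
Local Open Scope ring_scope.
Local Open Scope sesquilinear_scope.
Local Open Scope classical_set_scope.

Section PenroseEquations.
Context {C : numClosedFieldType} {m n : nat}.
Implicit Types (M : 'M[C]_(m, n)) (N : 'M[C]_(n, m)).

Definition penrose1 M N := M *m N *m M = M.
Definition penrose2 M N := N *m M *m N = N.
Definition penrose3 M N := (M *m N) ^t* = M *m N.
Definition penrose4 M N := (N *m M) ^t* = N *m M.

(* M{1}, M{2} and M{1,2} *)
Definition ginv1 M : set 'M[C]_(n, m) := [set N | penrose1 M N].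
Definition ginv2 M : set 'M[C]_(n, m) := [set N | penrose2 M N].
Definition ginv12 M : set 'M[C]_(n, m) := ginv1 M `&` ginv2 M.

Definition is_mpinv M N :=
  [/\ penrose1 M N, penrose2 M N, penrose3 M N & penrose4 M N].

(* MathComp's row-space operations ((_ <= _)%MS etc.) concern rows; this is the
   column space, as a set of column vectors. *)
Definition colrange M : set 'cV[C]_m := [set M *m x | x in [set: 'cV[C]_n]].

End PenroseEquations.

Definition EPmx {C : numClosedFieldType} {n} (M : 'M[C]_n) :=
  colrange M = colrange (M ^t*).

Section MoorePenrose.
Context {C : numClosedFieldType}.

Lemma trmxC_mul m n p (X : 'M[C]_(m, n)) (Y : 'M[C]_(n, p)) :
  (X *m Y) ^t* = Y ^t* *m X ^t*.
Proof. by rewrite trmx_mul map_mxM. Qed.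

Lemma mulmx_trmxC_eq0 m n (X : 'M[C]_(m, n)) : X *m X ^t* = 0 -> X = 0.
Proof.
move=> X0; apply/matrixP=> i j; rewrite mxE.
have /eqP := congr1 (fun Y : 'M_m => Y i i) X0; rewrite !mxE.
under eq_bigr do rewrite !mxE -normCK.
rewrite psumr_eq0 => [|k _]; last exact: exprn_ge0.
by move=> /allP/(_ j (mem_index_enum _)); rewrite /= sqrf_eq0 normr_eq0 => /eqP.
Qed.

Lemma row_free_gram_unit m n (X : 'M[C]_(m, n)) :
  row_free X -> X *m X ^t* \in unitmx.
Proof.
move=> freeX; rewrite -row_free_unit -kermx_eq0; set K := kermx _.
have K0 : K *m (X *m X ^t*) = 0 by exact: mulmx_ker.
have /mulmx_trmxC_eq0/eqP : (K *m X) *m (K *m X) ^t* = 0.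
  by rewrite trmxC_mul !mulmxA -[K *m X *m _]mulmxA K0 mul0mx.
by rewrite mulmx_free_eq0.
Qed.

Lemma mpinv_unique m n (M : 'M[C]_(m, n)) N1 N2 :
  is_mpinv M N1 -> is_mpinv M N2 -> N1 = N2.
Proof.
move=> [a1 a2 a3 a4] [b1 b2 b3 b4].
have MN : M *m N1 = M *m N2.
  have e : M *m N1 = (M *m N2) *m (M *m N1) by rewrite mulmxA b1.
  by rewrite -a3 e trmxC_mul a3 b3 mulmxA a1.
have NM : N1 *m M = N2 *m M.
  have e : N1 *m M = (N1 *m M) *m (N2 *m M) by rewrite -mulmxA [M *m _]mulmxA b1.
  by rewrite -a4 e trmxC_mul a4 b4 -mulmxA [M *m _]mulmxA a1.
by rewrite -a2 NM -mulmxA MN mulmxA b2.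
Qed.

(* Full-rank factorization M = L *m R gives R^* (R R^* )^-1 (L^* L)^-1 L^*. *)
Lemma mpinv_exists m n (M : 'M[C]_(m, n)) : exists N, is_mpinv M N.
Proof.
suff fact r (L : 'M[C]_(m, r)) (R : 'M[C]_(r, n)) :
    row_full L -> row_free R -> exists N, is_mpinv (L *m R) N.
  by rewrite -(mulmx_base M); apply: fact; [exact: col_base_full|exact: row_base_free].
move=> fullL freeR.
pose GR := R *m R ^t*; pose GL := L ^t* *m L.
have uR : GR \in unitmx by exact: row_free_gram_unit.
have uL : GL \in unitmx.
  rewrite /GL -{2}[L]trmxCK; apply: row_free_gram_unit.
  by rewrite /row_free mxrank_map mxrank_tr.
have hR : GR ^t* = GR by rewrite trmxC_mul trmxCK.
have hL : GL ^t* = GL by rewrite trmxC_mul trmxCK.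
have hV k (G : 'M[C]_k) : G ^t* = G -> (invmx G) ^t* = invmx G.
  by move=> hG; rewrite trmx_inv map_invmx hG.
pose N := R ^t* *m invmx GR *m (invmx GL *m L ^t*).
have MN : L *m R *m N = L *m invmx GL *m L ^t*.
  by rewrite /N -!mulmxA [R *m (_ *m _)]mulmxA (mulKVmx uR).
have NM : N *m (L *m R) = R ^t* *m invmx GR *m R.
  by rewrite /N -!mulmxA [_ ^t* *m (L *m _)]mulmxA (mulKmx uL).
exists N; split.
- by rewrite /penrose1 MN -!mulmxA [_ ^t* *m (L *m _)]mulmxA (mulKmx uL).
- by rewrite /penrose2 NM /N -!mulmxA [R *m (_ *m _)]mulmxA (mulKVmx uR).
- by rewrite /penrose3 MN !trmxC_mul trmxCK (hV _ _ hL) mulmxA.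
- by rewrite /penrose4 NM !trmxC_mul trmxCK (hV _ _ hR) mulmxA.
Qed.

Definition mpinv m n (M : 'M[C]_(m, n)) : 'M[C]_(n, m) :=
  sval (cid (mpinv_exists M)).

Lemma mpinvP m n (M : 'M[C]_(m, n)) : is_mpinv M (mpinv M).
Proof. exact: svalP (cid (mpinv_exists M)). Qed.

End MoorePenrose.

(* Main.v *)
(* Write G = A^* A and H = C C^*. Since ABC = APC and C^+ B^+ A^+ = C^+ Q A^+,
   with P and Q invariant under the projections A^+ A and C C^+, the outer
   factors can be cancelled from the Penrose equations, which turns (i) into
   (ii). All other conditions amount to: P and Q are {1,2}-inverses of each
   other, R(GP) = R(Q^* ) and R(HP^* ) = R(Q). As rank(GP) = rank(HP^* ) = rank P,
   each half of a condition bounds rank Q by rank P from one side, so the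
   weaker conditions force equal ranks and hence the missing inclusions. Every
   inclusion of column spaces is read, after conjugate transposition, as an
   inclusion of row spaces. *)
Require Import Defs.
From mathcomp Require Import all_boot all_order all_algebra.
From mathcomp Require Import sesquilinear spectral complex.
From mathcomp Require Import boolp classical_sets reals.

Set Implicit Arguments.
Unset Strict Implicit.
Unset Printing Implicit Defensive.

Import GRing.Theory Num.Theory.
Local Open Scope ring_scope.
Local Open Scope sesquilinear_scope.
Local Open Scope classical_set_scope.

(** * Column spaces, EP and Hermitian matrices as row-space conditions *)

Lemma colrange_subP (F : numClosedFieldType) m n p
    (X : 'M[F]_(m, n)) (Y : 'M[F]_(m, p)) :
  colrange X `<=` colrange Y <-> (X ^t* <= Y ^t*)%MS.
Proof.
split=> [sXY | /submxP[D eX] _ [x _ <-]].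
  (* It suffices to test the inclusion on the columns of [X], the images of the unit vectors. *)
  apply/row_subP => j; have [|x _ eXj] := sXY (X *m delta_mx j ord0).
    by exists (delta_mx j ord0).
  have -> : row j (X ^t*) = (X *m delta_mx j ord0) ^t*.
    by rewrite -colE; apply/rowP => k; rewrite !mxE.
  by rewrite -eXj trmxC_mul submxMl.
exists (D ^t* *m x) => //.
by rewrite -[X]trmxCK eX trmxC_mul trmxCK mulmxA.
Qed.

Lemma EPmxP (F : numClosedFieldType) n (X : 'M[F]_n) :
  EPmx X <-> (X == X ^t*)%MS.
Proof.
split=> [eX | /andP[sX sXt]].
  have s1 : colrange X `<=` colrange (X ^t*) by rewrite -eX.
  have s2 : colrange (X ^t*) `<=` colrange X by rewrite -eX.
  by apply/andP; split; move/colrange_subP: s1 s2 => s1 /colrange_subP;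
    rewrite trmxCK in s1 *.
by rewrite /EPmx eqEsubset; split; apply/colrange_subP; rewrite trmxCK.
Qed.

Lemma hermsymmxP (F : numClosedFieldType) n (X : 'M[F]_n) :
  X \is hermsymmx <-> X ^t* = X.
Proof.
rewrite qualifE /= expr0 scale1r.
by split=> [/eqP <- | ->].
Qed.

Lemma mxrank_trmxC (F : numClosedFieldType) m n (X : 'M[F]_(m, n)) :
  \rank (X ^t*) = \rank X.
Proof. by rewrite mxrank_map mxrank_tr. Qed.

(** * Gram matrices and the Moore-Penrose inverse *)

Lemma gram_mulmx_eq0 (F : numClosedFieldType) m n p
    (A : 'M[F]_(m, n)) (X : 'M[F]_(n, p)) :
  X ^t* *m (A ^t* *m A) *m X = 0 -> A *m X = 0.
Proof.
move=> AX0; rewrite -[A *m X]trmxCK [(A *m X) ^t*]mulmx_trmxC_eq0.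
  by rewrite trmx0 map_mx0.
by rewrite trmxCK trmxC_mul -AX0 !mulmxA.
Qed.

(** Lets the factor A^* A be cancelled in front of any matrix fixed by the projection A^+ A. It
    holds because A A^+ is Hermitian. *)
Lemma mpinv_gram (F : numClosedFieldType) m n (A : 'M[F]_(m, n)) :
  mpinv A *m (mpinv A) ^t* *m (A ^t* *m A) = mpinv A *m A.
Proof.
have [_ e2 e3 _] := mpinvP A.
rewrite -[_ *m _ *m _]mulmxA [_ *m (_ *m A)]mulmxA -trmxC_mul e3 !mulmxA.
by rewrite e2.
Qed.

Lemma mpinv_trmxC (F : numClosedFieldType) m n (A : 'M[F]_(m, n)) :
  mpinv (A ^t*) = (mpinv A) ^t*.
Proof.
have [e1 e2 e3 e4] := mpinvP A.
apply: (mpinv_unique (mpinvP _)); split.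
- by rewrite /penrose1 -!trmxC_mul mulmxA e1.
- by rewrite /penrose2 -!trmxC_mul mulmxA e2.
- by rewrite /penrose3 -!trmxC_mul e4.
- by rewrite /penrose4 -!trmxC_mul e3.
Qed.

Lemma mxrank_gram (F : numClosedFieldType) m n p
    (A : 'M[F]_(m, n)) (P : 'M[F]_(n, p)) :
  mpinv A *m A *m P = P -> \rank (P ^t* *m (A ^t* *m A)) = \rank P.
Proof.
move=> eP; rewrite -(mxrank_trmxC P); apply/eqP.
rewrite eqn_leq mxrankM_maxl /=.
have eP' : P ^t* = P ^t* *m (A ^t* *m A) *m (mpinv A *m (mpinv A) ^t*) ^t*.
  by rewrite -{1}eP -mpinv_gram !trmxC_mul !trmxCK !mulmxA.
by rewrite {1}eP' mxrankM_maxl.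
Qed.

(** * Equal ranks, row-space inclusions and generalized inverses *)

Lemma penrose12_of_rank (F : fieldType) n p (P : 'M[F]_(n, p)) (Q : 'M[F]_(p, n)) :
  P *m Q *m P = P -> \rank Q = \rank P -> Q *m P *m Q = Q.
Proof.
(* Since rank Q = rank P = rank PQP <= rank PQ, the row spaces of Q and PQ coincide. *)
move=> e1 rQP; have /submxP[Y eQ] : (Q <= P *m Q)%MS.
  have [_ <-] := mxrank_leqif_sup (submxMl P Q).
  by rewrite eqn_leq mxrankM_maxr rQP -{1}e1 mxrankM_maxl.
have -> : Q *m P *m Q = Y *m (P *m Q *m P) *m Q by rewrite {1}eQ !mulmxA.
by rewrite e1 -mulmxA -eQ.
Qed.

Lemma eqmx_of_rank (F : fieldType) m1 m2 n (X : 'M[F]_(m1, n)) (Y : 'M[F]_(m2, n)) :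
  \rank X = \rank Y -> (X <= Y)%MS || (Y <= X)%MS -> (X == Y)%MS.
Proof.
move=> rXY /orP[] s.
  by have [_ <-] := mxrank_leqif_eq s; rewrite rXY.
by rewrite andbC; have [_ <-] := mxrank_leqif_eq s; rewrite rXY.
Qed.

(* The inclusion gives P^* G = Z Q = Z QPQ = P^* G P Q with G = A^* A, so that
   (GPQ)^* = Q^* P^* G = Q^* P^* G P Q is Hermitian. *)
Lemma gram_hermitian (F : numClosedFieldType) m n p
    (A : 'M[F]_(m, n)) (P : 'M[F]_(n, p)) (Q : 'M[F]_(p, n)) :
  Q *m P *m Q = Q -> (P ^t* *m (A ^t* *m A) <= Q)%MS ->
  (A ^t* *m A *m P *m Q) ^t* = A ^t* *m A *m P *m Q.
Proof.
move=> e2 /submxP[Z eZ]; set G := A ^t* *m A in eZ *.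
have hG : G ^t* = G by rewrite trmxC_mul trmxCK.
clearbody G; have eG : P ^t* *m G *m P *m Q = P ^t* *m G.
  by rewrite eZ -!mulmxA [Q *m _]mulmxA e2.
have eT : (G *m P *m Q) ^t* = Q ^t* *m (P ^t* *m G).
  by rewrite !trmxC_mul hG.
rewrite -[RHS]trmxCK eT -eG !trmxC_mul !trmxCK hG.
by rewrite !mulmxA.
Qed.

(** With G = A^* A, the row space of GPQ is that of Q, as QPQ = Q and G cancels before P; the row
    space of (GPQ)^* = Q^* P^* G is that of P^* G, as PQP = P. Being EP identifies the two. *)
Lemma EPmx_gram (F : numClosedFieldType) m n p
    (A : 'M[F]_(m, n)) (P : 'M[F]_(n, p)) (Q : 'M[F]_(p, n)) :
  mpinv A *m A *m P = P -> P *m Q *m P = P -> Q *m P *m Q = Q ->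
  EPmx (A ^t* *m A *m P *m Q) -> (Q == P ^t* *m (A ^t* *m A))%MS.
Proof.
move=> eP e1 e2 /EPmxP; have := mpinv_gram A; set G := A ^t* *m A => eK.
have hG : G ^t* = G by rewrite trmxC_mul trmxCK.
clearbody G.
have -> : (G *m P *m Q) ^t* = Q ^t* *m (P ^t* *m G) by rewrite !trmxC_mul hG.
case/andP=> s1 s2; apply/andP; split.
  apply: submx_trans (submx_trans s1 (submxMl _ _)).
  have {1}-> : Q = Q *m (mpinv A *m (mpinv A) ^t*) *m (G *m P *m Q).
    by rewrite -{1}e2 -{1}eP -eK !mulmxA.
  exact: submxMl.
apply: submx_trans (submx_trans s2 (submxMl _ _)).
by rewrite -{1}e1 !trmxC_mul -!mulmxA submxMl.
Qed.

(* R(Q) lies in R(C C^* P^* ), on which P is injective: the idempotence of PQ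
   reads P(QPQ - Q) = 0, and P can be cancelled. *)
Lemma penrose2_of_idem (F : numClosedFieldType) n p q
    (C : 'M[F]_(p, q)) (P : 'M[F]_(n, p)) (Q : 'M[F]_(p, n)) :
  P *m Q = P *m Q *m (P *m Q) -> (Q ^t* <= P *m (C *m C ^t*))%MS ->
  Q *m P *m Q = Q.
Proof.
move=> idem /submxP[Y eY].
have eQ : Q = C *m (C ^t* *m P ^t* *m Y ^t*).
  by rewrite -[LHS]trmxCK eY !trmxC_mul trmxCK !mulmxA.
pose W := Q *m P *m Q - Q.
have PW0 : P *m W = 0 by rewrite mulmxBr idem !mulmxA subrr.
pose Z := P ^t* *m Y ^t* *m (P *m Q - 1%:M).
have eW : W = C *m (C ^t* *m Z).
  by rewrite /W -[Q *m P *m Q]mulmxA -{3}[Q]mulmx1 -mulmxBr {1}eQ /Z !mulmxA.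
(* With T = Y^* (PQ - 1), Z = P^* T and W = C C^* Z, so Z^* C C^* Z = T^* P W = 0, which forces C^*
   Z = 0. *)
suff : C ^t* *m Z = 0 by move=> CZ0; apply/eqP; rewrite -subr_eq0 -/W eW CZ0 mulmx0.
apply: gram_mulmx_eq0.
have -> : Z = P ^t* *m (Y ^t* *m (P *m Q - 1%:M)) by rewrite /Z mulmxA.
rewrite trmxCK trmxC_mul trmxCK -!mulmxA.
have -> : C *m (C ^t* *m (P ^t* *m (Y ^t* *m (P *m Q - 1%:M)))) = W.
  by rewrite eW /Z !mulmxA.
by rewrite PW0 mulmx0.
Qed.

(** * Cancelling the outer factors from the Penrose equations *)

Lemma hermitian_congr (F : numClosedFieldType) m n
    (X : 'M[F]_m) (Y : 'M[F]_(m, n)) :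
  X ^t* = X -> (Y ^t* *m X *m Y) ^t* = Y ^t* *m X *m Y.
Proof. by move=> hX; rewrite !trmxC_mul trmxCK hX mulmxA. Qed.

(** Each matrix is a congruence transform of the other, by A in one direction and by A^+ in the
    other, and congruence preserves being Hermitian. *)
Lemma hermitian_gram_mpinv (F : numClosedFieldType) m n
    (A : 'M[F]_(m, n)) (S : 'M[F]_n) :
  S *m (mpinv A *m A) = S ->
  (A *m S *m mpinv A) ^t* = A *m S *m mpinv A <->
  (A ^t* *m A *m S) ^t* = A ^t* *m A *m S.
Proof.
move=> eS; have [e1 _ e3 _] := mpinvP A.
have -> : A ^t* *m A *m S = A ^t* *m (A *m S *m mpinv A) *m A.
  by rewrite -{1}eS !mulmxA.
split=> [|h]; first exact: hermitian_congr.
have -> : A *m S *m mpinv A =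
    (mpinv A) ^t* *m (A ^t* *m (A *m S *m mpinv A) *m A) *m mpinv A.
  rewrite !mulmxA -trmxC_mul e3 e1 -!mulmxA.
  by rewrite [mpinv A *m (A *m _)]mulmxA [S *m (_ *m _)]mulmxA eS.
exact: hermitian_congr.
Qed.

Lemma hermitian_mpinv_gram (F : numClosedFieldType) p q
    (C : 'M[F]_(p, q)) (S : 'M[F]_p) :
  C *m mpinv C *m S = S ->
  (mpinv C *m S *m C) ^t* = mpinv C *m S *m C <->
  (S *m C *m C ^t*) ^t* = S *m C *m C ^t*.
Proof.
move=> eS.
(* The C side is the conjugate transpose of the A side. *)
have := @hermitian_gram_mpinv F _ _ (C ^t*) (S ^t*).
rewrite mpinv_trmxC -!trmxC_mul eS => /(_ erefl).
rewrite !mulmxA !trmxCK => h.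
by split=> /esym /h /esym.
Qed.

Lemma is_mpinv_mulmx (F : numClosedFieldType) m n p q (A : 'M[F]_(m, n))
    (P : 'M[F]_(n, p)) (Q : 'M[F]_(p, n)) (C : 'M[F]_(p, q)) :
  mpinv A *m A *m P = P -> P *m (C *m mpinv C) = P ->
  C *m mpinv C *m Q = Q -> Q *m (mpinv A *m A) = Q ->
  is_mpinv (A *m P *m C) (mpinv C *m Q *m mpinv A) <->
  [/\ P *m Q *m P = P, Q *m P *m Q = Q,
      (A ^t* *m A *m P *m Q) ^t* = A ^t* *m A *m P *m Q
    & (Q *m P *m C *m C ^t*) ^t* = Q *m P *m C *m C ^t*].
Proof.
move=> EP PF FQ QE.
have [_ a2 _ _] := mpinvP A; have [_ c2 _ _] := mpinvP C.
have MX : A *m P *m C *m (mpinv C *m Q *m mpinv A) = A *m (P *m Q) *m mpinv A.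
  by rewrite !mulmxA -(mulmxA (A *m P)) -(mulmxA A P) PF.
have XM : mpinv C *m Q *m mpinv A *m (A *m P *m C) = mpinv C *m (Q *m P) *m C.
  by rewrite !mulmxA -(mulmxA (mpinv C *m Q)) -(mulmxA _ Q) QE.
have MXM : A *m (P *m Q) *m mpinv A *m (A *m P *m C) = A *m (P *m Q *m P) *m C.
  transitivity (A *m (P *m Q *m (mpinv A *m A *m P)) *m C); last by rewrite EP.
  by rewrite !mulmxA.
have XMX : mpinv C *m (Q *m P) *m C *m (mpinv C *m Q *m mpinv A) =
           mpinv C *m (Q *m P *m Q) *m mpinv A.
  transitivity (mpinv C *m (Q *m P *m (C *m mpinv C *m Q)) *m mpinv A).
    by rewrite !mulmxA.
  by rewrite FQ.
(* Multiplying by A^+ and C^+ from outside leaves projections that fix X and Y; [cancelQ] does the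
   same with C and A. *)
have cancelP X Y : mpinv A *m A *m X = X -> X *m (C *m mpinv C) = X ->
    mpinv A *m A *m Y = Y -> Y *m (C *m mpinv C) = Y ->
    A *m X *m C = A *m Y *m C -> X = Y.
  move=> EX XF EY YF e; rewrite -XF -EX -YF -EY.
  by move/(congr1 (fun Z => mpinv A *m Z *m mpinv C)): e; rewrite !mulmxA.
have cancelQ X Y : C *m mpinv C *m X = X -> X *m (mpinv A *m A) = X ->
    C *m mpinv C *m Y = Y -> Y *m (mpinv A *m A) = Y ->
    mpinv C *m X *m mpinv A = mpinv C *m Y *m mpinv A -> X = Y.
  move=> EX XF EY YF e; rewrite -XF -EX -YF -EY.
  by move/(congr1 (fun Z => C *m Z *m A)): e; rewrite !mulmxA.
have h3 : (A *m (P *m Q) *m mpinv A) ^t* = A *m (P *m Q) *m mpinv A <->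
    (A ^t* *m A *m P *m Q) ^t* = A ^t* *m A *m P *m Q.
  rewrite -[A ^t* *m A *m P *m Q]mulmxA.
  by apply: hermitian_gram_mpinv; rewrite -mulmxA QE.
have h4 : (mpinv C *m (Q *m P) *m C) ^t* = mpinv C *m (Q *m P) *m C <->
    (Q *m P *m C *m C ^t*) ^t* = Q *m P *m C *m C ^t*.
  by apply: hermitian_mpinv_gram; rewrite mulmxA FQ.
split=> [[] | [e1 e2 /h3 e3 /h4 e4]].
  rewrite /penrose1 /penrose2 /penrose3 /penrose4 XM MX MXM XMX.
  move=> e1 e2 /h3 e3 /h4 e4; split=> //.
    by apply: (cancelP _ _ _ _ EP PF e1); [rewrite !mulmxA EP | rewrite -mulmxA PF].
  by apply: (cancelQ _ _ _ _ FQ QE e2); [rewrite !mulmxA FQ | rewrite -mulmxA QE].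
rewrite /is_mpinv /penrose1 /penrose2 /penrose3 /penrose4 XM MX MXM XMX.
by rewrite e1 e2.
Qed.

Theorem theorem2p9 (R : realType) (m n p q : nat)
    (A : 'M[R[i]]_(m, n)) (B : 'M[R[i]]_(n, p)) (C : 'M[R[i]]_(p, q)) :
  let P := mpinv A *m A *m B *m C *m mpinv C in
  let Q := C *m mpinv C *m mpinv B *m mpinv A *m A in
  [<-> (* i *)
       mpinv (A *m B *m C) = mpinv C *m mpinv B *m mpinv A;
       (* ii *)
       [/\ Q \in ginv12 P,
           A ^t* *m A *m P *m Q \is hermsymmx
         & Q *m P *m C *m C ^t* \is hermsymmx];
       (* iii *)
       [/\ Q \in ginv12 P,
           EPmx (A ^t* *m A *m P *m Q)
         & EPmx (Q *m P *m C *m C ^t*)];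
       (* iv, six variants *)
       [/\ Q \in ginv1 P,
           colrange (Q ^t*) `<=` colrange (A ^t* *m A *m P)
         & colrange (C *m C ^t* *m P ^t*) `<=` colrange Q];
       [/\ Q \in ginv1 P,
           colrange (A ^t* *m A *m P) `<=` colrange (Q ^t*)
         & colrange Q `<=` colrange (C *m C ^t* *m P ^t*)];
       [/\ Q \in ginv1 P,
           colrange (Q ^t*) `<=` colrange (A ^t* *m A *m P)
         & colrange Q `<=` colrange (C *m C ^t* *m P ^t*)];
       [/\ Q \in ginv2 P,
           colrange (Q ^t*) `<=` colrange (A ^t* *m A *m P)
         & colrange (C *m C ^t* *m P ^t*) `<=` colrange Q];
       [/\ Q \in ginv2 P,
           colrange (A ^t* *m A *m P) `<=` colrange (Q ^t*)
         & colrange Q `<=` colrange (C *m C ^t* *m P ^t*)];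
       [/\ Q \in ginv2 P,
           colrange (A ^t* *m A *m P) `<=` colrange (Q ^t*)
         & colrange (C *m C ^t* *m P ^t*) `<=` colrange Q];
       (* v, two variants *)
       [/\ P *m Q = (P *m Q) *m (P *m Q),
           colrange (Q ^t*) `<=` colrange (A ^t* *m A *m P)
         & colrange (C *m C ^t* *m P ^t*) `<=` colrange Q];
       [/\ P *m Q = (P *m Q) *m (P *m Q),
           colrange (A ^t* *m A *m P) `<=` colrange (Q ^t*)
         & colrange Q `<=` colrange (C *m C ^t* *m P ^t*)]].
Proof.
move=> P Q; set G := A ^t* *m A.
have [a1 a2 _ _] := mpinvP A; have [c1 c2 _ _] := mpinvP C.
have EE : mpinv A *m A *m (mpinv A *m A) = mpinv A *m A.
  by rewrite mulmxA a2.
have FF : C *m mpinv C *m (C *m mpinv C) = C *m mpinv C.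
  by rewrite mulmxA c1.
have EP : mpinv A *m A *m P = P by rewrite /P !mulmxA a2.
have PF : P *m (C *m mpinv C) = P.
  by rewrite /P -!mulmxA [C *m (_ *m (_ *m _))]mulmxA FF.
have FQ : C *m mpinv C *m Q = Q by rewrite /Q !mulmxA c1.
have QE : Q *m (mpinv A *m A) = Q.
  by rewrite /Q -!mulmxA [mpinv A *m (_ *m (_ *m _))]mulmxA EE.
have PF' : mpinv (C ^t*) *m C ^t* *m P ^t* = P ^t*.
  by rewrite mpinv_trmxC -!trmxC_mul PF.
have eM : A *m P *m C = A *m B *m C.
  by rewrite /P !mulmxA a1 -!mulmxA [C *m (_ *m _)]mulmxA c1.
have eX : mpinv C *m Q *m mpinv A = mpinv C *m mpinv B *m mpinv A.
  by rewrite /Q !mulmxA c2 -!mulmxA [mpinv A *m (_ *m _)]mulmxA a2.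
have i_iff : mpinv (A *m B *m C) = mpinv C *m mpinv B *m mpinv A <->
    is_mpinv (A *m P *m C) (mpinv C *m Q *m mpinv A).
  rewrite eM eX; split=> [<- | h]; first exact: mpinvP.
  exact: mpinv_unique (mpinvP _) h.
(* From here on B matters only through [i_iff]; P and Q are known only by the projections that fix
   them. *)
clearbody P Q.
pose U := P ^t* *m G; pose V := P *m (C *m C ^t*).
have rU : \rank U = \rank P by exact: mxrank_gram.
have rV : \rank V = \rank P.
  by rewrite -(mxrank_trmxC P) -(mxrank_gram PF') !trmxCK.
have hG : G ^t* = G by rewrite trmxC_mul trmxCK.
have ca1 : colrange (Q ^t*) `<=` colrange (G *m P) <-> (Q <= U)%MS.
  by rewrite colrange_subP trmxCK trmxC_mul hG.
have ca2 : colrange (G *m P) `<=` colrange (Q ^t*) <-> (U <= Q)%MS.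
  by rewrite colrange_subP trmxCK trmxC_mul hG.
have eV : (C *m C ^t* *m P ^t*) ^t* = V by rewrite !trmxC_mul !trmxCK.
have cb1 : colrange Q `<=` colrange (C *m C ^t* *m P ^t*) <-> (Q ^t* <= V)%MS.
  by rewrite colrange_subP eV.
have cb2 : colrange (C *m C ^t* *m P ^t*) `<=` colrange Q <-> (V <= Q ^t*)%MS.
  by rewrite colrange_subP eV.
have m1 : Q \in ginv1 P <-> P *m Q *m P = P by rewrite in_setE.
have m2 : Q \in ginv2 P <-> Q *m P *m Q = Q by rewrite in_setE.
have m12 : Q \in ginv12 P <-> P *m Q *m P = P /\ Q *m P *m Q = Q.
  by rewrite in_setE.
(* The common strong form: [expand] reads off from it all conditions of types (iv) and (v). *)
pose S := [/\ P *m Q *m P = P, Q *m P *m Q = Q, (Q == U)%MS & (Q ^t* == V)%MS].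
have hub : \rank Q = \rank P -> P *m Q *m P = P \/ Q *m P *m Q = Q ->
    (Q <= U)%MS || (U <= Q)%MS -> (Q ^t* <= V)%MS || (V <= Q ^t*)%MS -> S.
  move=> rQP h12 hU hV.
  have [e1 e2] : P *m Q *m P = P /\ Q *m P *m Q = Q.
    by case: h12 => e; split=> //; apply: penrose12_of_rank.
  by split=> //; apply: eqmx_of_rank; rewrite // ?rU ?rV // mxrank_trmxC.
have le_PQ1 : P *m Q *m P = P -> (\rank P <= \rank Q)%N.
  by move=> <-; rewrite (leq_trans (mxrankM_maxl _ _)) // mxrankM_maxr.
have le_QP2 : Q *m P *m Q = Q -> (\rank Q <= \rank P)%N.
  by move=> <-; rewrite (leq_trans (mxrankM_maxl _ _)) // mxrankM_maxr.
have le_QU : (Q <= U)%MS -> (\rank Q <= \rank P)%N.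
  by move/mxrankS; rewrite rU.
have le_UQ : (U <= Q)%MS -> (\rank P <= \rank Q)%N.
  by move/mxrankS; rewrite rU.
have le_QV : (Q ^t* <= V)%MS -> (\rank Q <= \rank P)%N.
  by move/mxrankS; rewrite rV mxrank_trmxC.
have le_VQ : (V <= Q ^t*)%MS -> (\rank P <= \rank Q)%N.
  by move/mxrankS; rewrite rV mxrank_trmxC.
have rk : (\rank Q <= \rank P)%N -> (\rank P <= \rank Q)%N -> \rank Q = \rank P.
  by move=> h1 h2; apply/eqP; rewrite eqn_leq h1.
have expand : S -> ([/\ Q \in ginv1 P, Q \in ginv2 P & P *m Q = P *m Q *m (P *m Q)]
    /\ (colrange (Q ^t*) `<=` colrange (G *m P) /\
        colrange (G *m P) `<=` colrange (Q ^t*))) /\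
    (colrange Q `<=` colrange (C *m C ^t* *m P ^t*) /\
     colrange (C *m C ^t* *m P ^t*) `<=` colrange Q).
  move=> [e1 e2 /andP[/ca1 s1 /ca2 s2] /andP[/cb1 s3 /cb2 s4]].
  by do !split=> //; [exact/m1 | exact/m2 | rewrite mulmxA e1].
have eT : C *m C ^t* *m P ^t* *m Q ^t* = (Q *m P *m C *m C ^t*) ^t*.
  by rewrite !trmxC_mul trmxCK !mulmxA.
tfae.
- move/i_iff/(is_mpinv_mulmx EP PF FQ QE) => [e1 e2 e3 e4].
  by split; [apply/m12 | apply/hermsymmxP..].
- by move=> [h /hermsymmxP h3 /hermsymmxP h4]; split=> //; rewrite /EPmx ?h3 ?h4.
- move=> [/m12[e1 e2] h3 h4].
  suff /expand[[[? ? ?] [? ?]] [? ?]] : S by split.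
  split=> //; first exact: EPmx_gram.
  (* Conjugate transposition turns QPCC^* into the Gram form for C^*, and EP is symmetric under
     it. *)
  have := @EPmx_gram _ _ _ _ (C ^t*) (P ^t*) (Q ^t*).
  rewrite !trmxCK eT => h; apply: h => //.
  + by rewrite -!trmxC_mul mulmxA e1.
  + by rewrite -!trmxC_mul mulmxA e2.
  + by rewrite EPmxP trmxCK andbC; apply/EPmxP.
- move=> [/m1 e1 /ca1 s1 /cb2 s2].
  suff /expand[[[? ? ?] [? ?]] [? ?]] : S by split.
  by apply: hub; rewrite ?s1 ?s2 ?orbT; auto.
- move=> [/m1 e1 /ca2 s1 /cb1 s2].
  suff /expand[[[? ? ?] [? ?]] [? ?]] : S by split.
  by apply: hub; rewrite ?s1 ?s2 ?orbT; auto.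
- move=> [/m1 e1 /ca1 s1 /cb1 s2].
  suff /expand[[[? ? ?] [? ?]] [? ?]] : S by split.
  by apply: hub; rewrite ?s1 ?s2 ?orbT; auto.
- move=> [/m2 e2 /ca1 s1 /cb2 s2].
  suff /expand[[[? ? ?] [? ?]] [? ?]] : S by split.
  by apply: hub; rewrite ?s1 ?s2 ?orbT; auto.
- move=> [/m2 e2 /ca2 s1 /cb1 s2].
  suff /expand[[[? ? ?] [? ?]] [? ?]] : S by split.
  by apply: hub; rewrite ?s1 ?s2 ?orbT; auto.
- move=> [/m2 e2 /ca2 s1 /cb2 s2].
  suff /expand[[[? ? ?] [? ?]] [? ?]] : S by split.
  by apply: hub; rewrite ?s1 ?s2 ?orbT; auto.
- move=> [idem /ca1 s1 /cb2 s2].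
  (* The two inclusions bound rank Q by rank P from opposite sides. Equality reverses the second
     one, as [penrose2_of_idem] requires. *)
  have rQP : \rank Q = \rank P by auto.
  have /andP[s3 _] : (Q ^t* == V)%MS.
    by apply: eqmx_of_rank; rewrite ?s2 ?orbT // rV mxrank_trmxC.
  suff /expand[[[? ? ?] [? ?]] [? ?]] : S by split.
  by apply: hub; rewrite ?s1 ?s2 ?orbT //; right; apply: penrose2_of_idem s3.
move=> [idem /ca2 s1 /cb1 s2].
have [e1 e2 /andP[_ s3] /andP[_ s4]] : S.
  apply: hub; rewrite ?s1 ?s2 ?orbT //; auto.
  by right; apply: penrose2_of_idem s2.
(* The cycle closes at (i); the second Hermitian condition is again the first one for C^*, P^*,
   Q^*. *)
apply/i_iff/(is_mpinv_mulmx EP PF FQ QE); split=> //; first exact: gram_hermitian.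
have := @gram_hermitian _ _ _ _ (C ^t*) (P ^t*) (Q ^t*).
rewrite !trmxCK eT trmxCK => h; apply: esym (h _ _) => //.
by rewrite -!trmxC_mul mulmxA e2.
Qed.
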